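(* Let $k$ be a field with $\operatorname{char} k\neq 2$, let $\beta,\delta\in k$, and let $L$ be a Lie algebra over $k$ with a basis $\{e_1,e_2,e_3\}$ such that $$[e_1,e_2]=0,\quad [e_1,e_3]=e_1+\beta e_2,\quad [e_2,e_3]=\delta e_2 .$$ Let $p,s,u\in k$ and $$r=p(e_1\otimes e_2)-p(e_2\otimes e_1)+s(e_1\otimes e_3)-s(e_3\otimes e_1)+u(e_2\otimes e_3)-u(e_3\otimes e_2).$$ Then: (I) $(L,[\ ],\Delta_r,r)$ is a coboundary Lie bialgebra if and only if $(\delta+1)\bigl((\delta-1)u+\beta s\bigr)s=0$; (II) if $\beta=0$, then $(L,[\ ],\Delta_r,r)$ is a triangular Lie bialgebra if and only if $(1-\delta)us=0$; (III) if $\beta\neq 0$ and $\delta=1$, then the following are equivalent: $(L,[\ ],\Delta_r,r)$ is a triangular Lie bialgebra; $s=0$; $(L,[\ ],\Delta_r,r)$ is a coboundary Lie bialgebra.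
   Context: Let $L$ be a Lie algebra over $k$. For $r=\sum_i a_i\otimes b_i\in L\otimes L$ and $x\in L$ put $x\cdot r=\sum_i([x,a_i]\otimes b_i+a_i\otimes[x,b_i])$ and $\Delta_r(x)=x\cdot r$. The element $r$ is a solution of the classical Yang–Baxter equation (CYBE) if $[r^{12},r^{13}]+[r^{12},r^{23}]+[r^{13},r^{23}]=0$ in $L\otimes L\otimes L$, where $[r^{12},r^{13}]=\sum_{i,j}[a_i,a_j]\otimes b_i\otimes b_j$, $[r^{12},r^{23}]=\sum_{i,j}a_i\otimes[b_i,a_j]\otimes b_j$, $[r^{13},r^{23}]=\sum_{i,j}a_i\otimes a_j\otimes[b_i,b_j]$. Let $\tau(x\otimes y)=y\otimes x$ on $L\otimes L$ and $\xi(x\otimes y\otimes z)=y\otimes z\otimes x$ on $L\otimes L\otimes L$. A vector space $L$ with a linear map $\Delta:L\to L\otimes L$ is a Lie coalgebra if (i) $\operatorname{Im}\Delta\subseteq\operatorname{Im}(1-\tau)$ and (ii) $(1+\xi+\xi^2)(1\otimes\Delta)\Delta=0$. $(L,[\ ],\Delta)$ is a Lie bialgebra if $(L,[\ ])$ is a Lie algebra, $(L,\Delta)$ is a Lie coalgebra, and $\Delta[x,y]=x\cdot\Delta(y)-y\cdot\Delta(x)$ for all $x,y\in L$. $(L,[\ ],\Delta,r)$ is a coboundary Lie bialgebra if $(L,[\ ],\Delta)$ is a Lie bialgebra, $r\in\operatorname{Im}(1-\tau)\subseteq L\otimes L$, and $\Delta(x)=x\cdot r$ for all $x\in L$. A coboundary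 Lie bialgebra $(L,[\ ],\Delta,r)$ is triangular if $r$ is a solution of the CYBE. *)

(* Defs.v *)
From HB Require Import structures.
From mathcomp Require Import all_boot all_order all_algebra.

Set Implicit Arguments.
Unset Strict Implicit.
Unset Printing Implicit Defensive.

Import GRing.Theory.
Local Open Scope ring_scope.

(* The tensor product of two finite-dimensional spaces, modelled by coordinate
   matrices: M stands for the sum of the M i j *: (b_i ⊗ c_j), where (b_i) and
   (c_j) are the reference bases vbasis {:U} and vbasis {:V}.  The universal
   property (lemmas tens_bilinear, tlift_linear, tlift_tens and tlift_uniq)
   shows that nothing depends on these bases. *)
Definition tensor (k : fieldType) (U V : vectType k) : vectType k :=
  'M[k]_(\dim {:U}, \dim {:V}).

Definition tens (k : fieldType) (U V : vectType k) (u : U) (v : V) :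
    tensor U V :=
  \matrix_(i, j) (coord (vbasis {:U}) i u * coord (vbasis {:V}) j v).

Notation "u ⊗ v" := (tens u v) (at level 40, left associativity) : ring_scope.

(* The linear map sending u ⊗ v to f u v, for f bilinear: on t = sum_n a_n ⊗ b_n
   its value is sum_n f a_n b_n. *)
Definition tlift (k : fieldType) (U V W : vectType k) (f : U -> V -> W)
    (t : tensor U V) : W :=
  \sum_i \sum_j t i j *: f (vbasis {:U})`_i (vbasis {:V})`_j.

Definition is_bilinear (k : fieldType) (U V W : vectType k) (f : U -> V -> W) :
    Prop :=
  bilinear_for *:%R *:%R f.

Lemma tens_bilinear (k : fieldType) (U V : vectType k) :
  is_bilinear (@tens k U V).
Proof.
split=> x a y z; apply/matrixP=> i j; rewrite !mxE linearP /=.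
  by rewrite mulrDl mulrA.
by rewrite mulrDr !mulrA (mulrC _ a).
Qed.

Lemma tlift_linear (k : fieldType) (U V W : vectType k) (f : U -> V -> W) :
  linear (tlift f).
Proof.
move=> a s t; rewrite /tlift scaler_sumr -big_split; apply: eq_bigr => i _ /=.
rewrite scaler_sumr -big_split; apply: eq_bigr => j _ /=.
by rewrite !mxE scalerDl scalerA.
Qed.

Lemma tlift_tens (k : fieldType) (U V W : vectType k) (f : U -> V -> W) u v :
  is_bilinear f -> tlift f (u ⊗ v) = f u v.
Proof.
case=> fl fr.
have fls n (c : 'I_n -> k) (x : 'I_n -> U) w :
    f (\sum_i c i *: x i) w = \sum_i c i *: f (x i) w.
  elim: n c x => [|n IHn] c x; last by rewrite !big_ord_recl fl IHn.
  rewrite !big_ord0; apply: (addrI (f 0 w)); rewrite addr0.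
  by have := fl w 1 0 0; rewrite /= !scale1r addr0.
have frs n (c : 'I_n -> k) (x : 'I_n -> V) w :
    f w (\sum_i c i *: x i) = \sum_i c i *: f w (x i).
  elim: n c x => [|n IHn] c x; last by rewrite !big_ord_recl fr IHn.
  rewrite !big_ord0; apply: (addrI (f w 0)); rewrite addr0.
  by have := fr w 1 0 0; rewrite /= !scale1r addr0.
rewrite {2}(coord_vbasis (memvf u)) fls; apply: eq_bigr => i _.
rewrite {2}(coord_vbasis (memvf v)) frs scaler_sumr; apply: eq_bigr => j _.
by rewrite mxE scalerA.
Qed.

Lemma tlift_uniq (k : fieldType) (U V W : vectType k) (f : U -> V -> W)
    (g : tensor U V -> W) :
  linear g -> (forall u v, g (u ⊗ v) = f u v) -> g =1 tlift f.
Proof.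
move=> gl gf t.
pose hgl := GRing.isLinear.Build _ _ _ _ g gl.
pose G : {linear tensor U V -> W} := HB.pack g hgl.
have tE : t = \sum_i \sum_j t i j *: ((vbasis {:U})`_i ⊗ (vbasis {:V})`_j).
  apply/matrixP=> a b; rewrite summxE (bigD1 a) //= summxE (bigD1 b) //=.
  rewrite !mxE !coord_free ?(basis_free (vbasisP _)) // !eqxx !mulr1.
  rewrite !big1 ?addr0 // => [i neq|j neq].
    rewrite summxE big1 // => j _; rewrite !mxE.
    rewrite coord_free ?(basis_free (vbasisP _)) //.
    by rewrite (negbTE neq) mul0r mulr0.
  rewrite !mxE !coord_free ?(basis_free (vbasisP _)) //.
  by rewrite (negbTE neq) !mulr0.
rewrite -[g t]/(G t) {1}tE linear_sum; apply: eq_bigr => i _.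
by rewrite linear_sum; apply: eq_bigr => j _; rewrite linearZ /= gf.
Qed.

Definition tmap (k : fieldType) (U V U' V' : vectType k)
    (f : U -> U') (g : V -> V') : tensor U V -> tensor U' V' :=
  tlift (fun x y => f x ⊗ g y).

Definition tau (k : fieldType) (L : vectType k) : tensor L L -> tensor L L :=
  tlift (fun x y => y ⊗ x).

(* L ⊗ L ⊗ L is read as tensor L (tensor L L), and x ⊗ y ⊗ z as x ⊗ (y ⊗ z). *)
Definition xi (k : fieldType) (L : vectType k) :
    tensor L (tensor L L) -> tensor L (tensor L L) :=
  tlift (fun x => tlift (fun y z => y ⊗ (z ⊗ x))).

Definition in_im_1_sub_tau (k : fieldType) (L : vectType k) (t : tensor L L) :
    Prop :=
  exists t' : tensor L L, t = t' - tau t'.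

Definition lie_algebra (k : fieldType) (L : vectType k) (br : L -> L -> L) :
    Prop :=
  [/\ is_bilinear br,
      forall x, br x x = 0
    & forall x y z, br x (br y z) + br y (br z x) + br z (br x y) = 0].

Definition act (k : fieldType) (L : vectType k) (br : L -> L -> L) (x : L) :
    tensor L L -> tensor L L :=
  tlift (fun a b => br x a ⊗ b + a ⊗ br x b).

Definition Delta_of (k : fieldType) (L : vectType k) (br : L -> L -> L)
    (r : tensor L L) (x : L) : tensor L L :=
  act br x r.

(* The two nested tlifts run over two independent copies sum_i a_i ⊗ b_i and
   sum_j a_j ⊗ b_j of r. *)
Definition br_r12_r13 (k : fieldType) (L : vectType k) (br : L -> L -> L)
    (r : tensor L L) : tensor L (tensor L L) :=
  tlift (fun a b => tlift (fun a' b' => br a a' ⊗ (b ⊗ b')) r) r.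

Definition br_r12_r23 (k : fieldType) (L : vectType k) (br : L -> L -> L)
    (r : tensor L L) : tensor L (tensor L L) :=
  tlift (fun a b => tlift (fun a' b' => a ⊗ (br b a' ⊗ b')) r) r.

Definition br_r13_r23 (k : fieldType) (L : vectType k) (br : L -> L -> L)
    (r : tensor L L) : tensor L (tensor L L) :=
  tlift (fun a b => tlift (fun a' b' => a ⊗ (a' ⊗ br b b')) r) r.

Definition cybe (k : fieldType) (L : vectType k) (br : L -> L -> L)
    (r : tensor L L) : Prop :=
  br_r12_r13 br r + br_r12_r23 br r + br_r13_r23 br r = 0.

Definition lie_coalgebra (k : fieldType) (L : vectType k)
    (Delta : L -> tensor L L) : Prop :=
  [/\ linear Delta,
      forall x, in_im_1_sub_tau (Delta x)
    & forall x, let t := tmap id Delta (Delta x) in t + xi t + xi (xi t) = 0].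

Definition lie_bialgebra (k : fieldType) (L : vectType k) (br : L -> L -> L)
    (Delta : L -> tensor L L) : Prop :=
  [/\ lie_algebra br, lie_coalgebra Delta
    & forall x y, Delta (br x y) = act br x (Delta y) - act br y (Delta x)].

Definition coboundary_lie_bialgebra (k : fieldType) (L : vectType k)
    (br : L -> L -> L) (Delta : L -> tensor L L) (r : tensor L L) : Prop :=
  [/\ lie_bialgebra br Delta, in_im_1_sub_tau r
    & forall x, Delta x = act br x r].

Definition triangular_lie_bialgebra (k : fieldType) (L : vectType k)
    (br : L -> L -> L) (Delta : L -> tensor L L) (r : tensor L L) : Prop :=
  coboundary_lie_bialgebra br Delta r /\ cybe br r.

(* Main.v *)
Require Import Defs.
From HB Require Import structures.
From mathcomp Require Import all_boot all_order all_algebra.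
From mathcomp Require Import ring.

Import GRing.Theory.
Local Open Scope ring_scope.

(** The result is a computation in the exterior cube of [L], which is a line.

    Write [a ∧ b = a ⊗ b - b ⊗ a] ([wedge]), [J = 1 + xi + xi^2] ([cyc]) and
    [a ∧ b ∧ c = J (a ⊗ (b ∧ c))] ([vol]); the latter is alternating, and
    [e1 ∧ e2 ∧ e3] is nonzero because the [e_i] form a basis ([vol_neq0]).
    For [r] in [Im (1 - tau)] every requirement on a coboundary Lie bialgebra
    but one is automatic: [x . _] is an action of the Lie algebra [L] ([act_bracket]),
    which gives the cocycle identity, and it commutes with [tau]
    ([act_im_1_sub_tau]), so [Delta_r x] lies in [Im (1 - tau)] too.  What
    remains is the co-Jacobi identity.

    With [c = (delta - 1) u + beta s], the values of [Delta_r] on the basis are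
    - [Delta_r e1 = (beta s - u) e1 ∧ e2],
    - [Delta_r e2 = delta s e1 ∧ e2],
    - [Delta_r e3 = - p (1 + delta) e1 ∧ e2 - s e1 ∧ e3
                    - (beta s + delta u) e2 ∧ e3].

    Set [K t = J ((1 ⊗ Delta_r) t)].  Since [a ∧ b ∧ c] is alternating, [K]
    sends each [e_i ∧ e_j] to an explicit multiple of [e1 ∧ e2 ∧ e3]
    ([cyc_tmap_id]), whence
    - [K (Delta_r e1) = K (Delta_r e2) = 0] and
      [K (Delta_r e3) = (delta + 1) c s (e1 ∧ e2 ∧ e3)]: co-Jacobi holds if and
      only if [(delta + 1) c s = 0];
    - [K r = - 2 c s (e1 ∧ e2 ∧ e3)].

    The same [K] decides the classical Yang-Baxter equation: for skew [r] the
    three brackets [[r13,r23]], [[r12,r23]], [[r12,r13]] are permuted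
    cyclically by [xi], and [(1 ⊗ Delta_r) r] is the sum of the first two, so
    [K r] is twice the left side of the equation ([cybe_double]).  As
    [char k <> 2], the equation holds if and only if [c s = 0].

    The left side of the equation is thus [- c s (e1 ∧ e2 ∧ e3)], and the extra
    factor in [K (Delta_r e3)] has a meaning: [K (Delta_r x)] is [x] acting on
    that element, and [L] acts on its exterior cube by the trace of [ad], with
    [tr (ad e3) = - (1 + delta)].

    Hence coboundary means [(delta + 1) c s = 0] and triangular means
    [c s = 0]; parts II and III specialize [c] to [(delta - 1) u] and to
    [beta s]. *)

(** * Calculus of tensors *)

Section TensorCalculus.
Context {k : fieldType}.
Implicit Types U V W : vectType k.

HB.instance Definition _ U V W (f : U -> V -> W) :=
  GRing.isLinear.Build k (tensor U V) W *:%R (tlift f) (@tlift_linear k U V W f).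

Lemma eq_tlift {U V W} {f g : U -> V -> W} (t : tensor U V) :
  (forall u v, f u v = g u v) -> tlift f t = tlift g t.
Proof.
by move=> fg; apply: eq_bigr => i _; apply: eq_bigr => j _; rewrite fg.
Qed.

Lemma tlift_fun_linear {U V W} (f g h : U -> V -> W) (a : k) (t : tensor U V) :
  (forall u v, f u v = a *: g u v + h u v) ->
  tlift f t = a *: tlift g t + tlift h t.
Proof.
move=> fE; rewrite /tlift scaler_sumr -big_split; apply: eq_bigr => i _ /=.
rewrite scaler_sumr -big_split; apply: eq_bigr => j _ /=.
by rewrite fE scalerDr !scalerA mulrC.
Qed.

(** With this, identities between linear maps out of a tensor product are
    checked on pure tensors by [eq_tlift], without choosing a presentation. *)
Lemma linear_tlift {U V W W'} (g : {linear W -> W'}) (f : U -> V -> W)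
    (t : tensor U V) :
  g (tlift f t) = tlift (fun u v => g (f u v)) t.
Proof.
rewrite /tlift linear_sum; apply: eq_bigr => i _; rewrite linear_sum.
by apply: eq_bigr => j _; rewrite linearZ.
Qed.

Lemma tliftN {U V W} (f : U -> V -> W) (t : tensor U V) :
  tlift (fun u v => - f u v) t = - tlift f t.
Proof.
rewrite /tlift -sumrN; apply: eq_bigr => i _; rewrite -sumrN.
by apply: eq_bigr => j _; rewrite scalerN.
Qed.

Lemma tliftD {U V W} (f g : U -> V -> W) (t : tensor U V) :
  tlift (fun u v => f u v + g u v) t = tlift f t + tlift g t.
Proof.
by rewrite -[tlift f t]scale1r; apply: tlift_fun_linear => u v; rewrite scale1r.
Qed.

(** Two copies of a tensor, as they occur in the three brackets of the
    Yang-Baxter equation, may be run over in either order. *)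
Lemma tlift_exchange {U V U' V' W} (f : U -> V -> U' -> V' -> W)
    (t : tensor U V) (t' : tensor U' V') :
  tlift (fun a b => tlift (f a b) t') t =
  tlift (fun a' b' => tlift (fun a b => f a b a' b') t) t'.
Proof.
rewrite /tlift.
under eq_bigr do under eq_bigr do rewrite scaler_sumr.
under eq_bigr do rewrite exchange_big.
rewrite exchange_big; apply: eq_bigr => i _ /=.
under eq_bigr do under eq_bigr do rewrite scaler_sumr.
under eq_bigr do rewrite exchange_big.
rewrite exchange_big; apply: eq_bigr => j _ /=.
rewrite scaler_sumr; apply: eq_bigr => a _.
rewrite scaler_sumr; apply: eq_bigr => b _.
by rewrite !scalerA mulrC.
Qed.

Definition skew {L : vectType k} (t : tensor L L) : Prop :=
  forall i j, t i j = - t j i.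

(** The coefficientwise form of replacing [sum a ⊗ b] by [- sum b ⊗ a]; it
    applies to one copy of [r] at a time inside a nested [tlift]. *)
Lemma tlift_skew {L : vectType k} {W} (f : L -> L -> W) (t : tensor L L) :
  skew t -> tlift f t = - tlift (fun a b => f b a) t.
Proof.
move=> skt; rewrite /tlift exchange_big -sumrN; apply: eq_bigr => i _ /=.
by rewrite -sumrN; apply: eq_bigr => j _; rewrite skt scaleNr.
Qed.

Lemma tens_linearl {U V} (v : V) (a : k) (x y : U) :
  (a *: x + y) ⊗ v = a *: (x ⊗ v) + y ⊗ v.
Proof. exact: (tens_bilinear U V).1. Qed.

Lemma tens_linearr {U V} (u : U) (a : k) (x y : V) :
  u ⊗ (a *: x + y) = a *: (u ⊗ x) + u ⊗ y.
Proof. exact: (tens_bilinear U V).2. Qed.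

HB.instance Definition _ U V (u : U) :=
  GRing.isLinear.Build k V (tensor U V) *:%R (tens u) (tens_linearr u).

(** Names the partial application [_ ⊗ v], so that it can be declared linear. *)
Definition tensr {U V} (v : V) (u : U) : tensor U V := u ⊗ v.

HB.instance Definition _ U V (v : V) :=
  GRing.isLinear.Build k U (tensor U V) *:%R (tensr v) (tens_linearl v).

Lemma tensNl {U V} (u : U) (v : V) : (- u) ⊗ v = - (u ⊗ v).
Proof. exact: (linearN (tensr v)). Qed.

End TensorCalculus.

(** * Cyclic sums and the exterior cube *)

Section CyclicSum.
Context {k : fieldType} {L : vectType k}.

HB.instance Definition _ :=
  GRing.isLinear.Build k (tensor L L) (tensor L L) *:%R
  (@tau k L) (@tlift_linear _ _ _ _ _).
HB.instance Definition _ :=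
  GRing.isLinear.Build k (tensor L (tensor L L)) (tensor L (tensor L L)) *:%R
  (@xi k L) (@tlift_linear _ _ _ _ _).

Lemma tau_tens (a b : L) : tau (a ⊗ b) = b ⊗ a.
Proof.
rewrite /tau tlift_tens //; split=> x c y z.
  exact: tens_linearr.
exact: tens_linearl.
Qed.

Lemma xi_tens (a b c : L) : xi (a ⊗ (b ⊗ c)) = b ⊗ (c ⊗ a).
Proof.
have bil x : is_bilinear (fun y z : L => y ⊗ (z ⊗ x)).
  split=> y d z t; first exact: tens_linearl.
  by rewrite tens_linearl tens_linearr.
rewrite /xi !tlift_tens //; split=> x d y z; last exact: tlift_linear.
by apply: tlift_fun_linear => v w; rewrite !linearP.
Qed.

Definition cyc (t : tensor L (tensor L L)) : tensor L (tensor L L) :=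
  t + xi t + xi (xi t).

Lemma cyc_linear : linear cyc.
Proof.
by move=> a x y; rewrite /cyc !linearP !scalerDr !addrA; rewrite (ACl (1*3*5*2*4*6)).
Qed.
HB.instance Definition _ :=
  GRing.isLinear.Build k _ _ *:%R cyc cyc_linear.

Definition wedge (a b : L) : tensor L L := a ⊗ b - b ⊗ a.

Definition vol (a b c : L) : tensor L (tensor L L) := cyc (a ⊗ wedge b c).

Lemma wedgexx a : wedge a a = 0.
Proof. exact: subrr. Qed.

Lemma wedgeC a b : wedge a b = - wedge b a.
Proof. by rewrite /wedge opprB. Qed.

Lemma vol_rot a b c : vol a b c = vol b c a.
Proof.
rewrite /vol /wedge !linearB /= /cyc !xi_tens.
by congr (_ - _); [rewrite -addrA addrC | rewrite addrC addrA].
Qed.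

Lemma volaab a b : vol a a b = 0.
Proof. by rewrite vol_rot vol_rot /vol wedgexx !linear0. Qed.

Lemma volaba a b : vol a b a = 0.
Proof. by rewrite vol_rot /vol wedgexx !linear0. Qed.

Lemma volC a b c : vol a b c = - vol a c b.
Proof. by rewrite /vol wedgeC !linearN. Qed.

(** The linear form on [L ⊗ L ⊗ L] given by the product of the three coordinate
    forms takes the value 1 on [a ⊗ b ⊗ c] and 0 on its five permutations. *)
Lemma vol_neq0 (a b c : L) : basis_of {:L} [:: a; b; c] -> vol a b c != 0.
Proof.
move=> /basis_free fr.
pose X := [tuple a; b; c].
pose co (m : nat) (v : L) : k := coord X (inord m) v.
have scE (d x : k) : d *: (x : k^o) = d * x by [].
have coL i d v w : co i (d *: v + w) = d * co i v + co i w by rewrite /co linearP.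
pose F x : tensor L L -> k^o :=
  tlift (fun y z => co 0%N x * co 1%N y * co 2%N z : k^o).
have coE x y z : tlift F (x ⊗ (y ⊗ z)) = co 0%N x * co 1%N y * co 2%N z.
  have bil v : is_bilinear (fun y z => co 0%N v * co 1%N y * co 2%N z : k^o).
    by split=> v1 d v2 v3; rewrite coL /= scE; ring.
  rewrite tlift_tens; last first.
    split=> v1 d v2 v3; last exact: tlift_linear.
    apply: tlift_fun_linear => v4 v5.
    by rewrite coL /= scE; ring.
  by rewrite /F tlift_tens.
apply: (contra_neq (z1 := tlift F (vol a b c)) (z2 := 0)) => [->|].
  exact: linear0.
rewrite /vol /wedge !linearB /= /cyc !xi_tens !linearD /= !coE.
have coX m n : (m < 3)%N -> (n < 3)%N -> co m X`_n = (m == n)%:R.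
  move=> m3 n3; rewrite -[n in X`_n](@inordK 2) // /co coord_free //.
  by rewrite -val_eqE /= !inordK // eq_sym.
have ca m (m3 : (m < 3)%N) : co m a = (m == 0%N)%:R := coX m 0%N m3 isT.
have cb m (m3 : (m < 3)%N) : co m b = (m == 1%N)%:R := coX m 1%N m3 isT.
have cc m (m3 : (m < 3)%N) : co m c = (m == 2%N)%:R := coX m 2%N m3 isT.
rewrite !ca // !cb // !cc // !eqE /= !(mulr0, mul0r, mulr1, oppr0, addr0).
exact: oner_neq0.
Qed.

End CyclicSum.

(** * The adjoint action and the three brackets *)

Section Bracket.
Context {k : fieldType} {L : vectType k}.

HB.instance Definition _ (M : vectType k) (D : L -> M) :=
  GRing.isLinear.Build k (tensor L L) (tensor L M) *:%R
  (tmap id D) (@tlift_linear _ _ _ _ _).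

Lemma tmap_id_tens (D : {linear L -> tensor L L}) (a b : L) :
  tmap id D (a ⊗ b) = a ⊗ D b.
Proof.
rewrite /tmap tlift_tens //; split=> x c y z; first exact: tens_linearl.
by rewrite linearP tens_linearr.
Qed.

Lemma cyc_tmap_wedge (D : {linear L -> tensor L L}) (a b : L) :
  cyc (tmap id D (wedge a b)) = cyc (a ⊗ D b) - cyc (b ⊗ D a).
Proof. by rewrite /wedge !linearB /= !tmap_id_tens. Qed.

Context {br : L -> L -> L} (L_lie : lie_algebra br).

Lemma br_linearl z a x y : br (a *: x + y) z = a *: br x z + br y z.
Proof. by case: L_lie => -[brl _] _ _; exact: brl. Qed.

Lemma br_linearr z a x y : br z (a *: x + y) = a *: br z x + br z y.
Proof. by case: L_lie => -[_ brr] _ _; exact: brr. Qed.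

HB.instance Definition _ x := GRing.isLinear.Build k L L *:%R (br x) (br_linearr x).

Lemma brxx x : br x x = 0.
Proof. by case: L_lie. Qed.

Lemma brDl x y z : br (x + y) z = br x z + br y z.
Proof. by have := br_linearl z 1 x y; rewrite !scale1r. Qed.

Lemma brC x y : br x y = - br y x.
Proof.
apply/eqP; rewrite -addr_eq0; apply/eqP.
by have := brxx (x + y); rewrite brDl !linearD /= !brxx add0r addr0.
Qed.

(** The Jacobi identity, in the form: [ad] is a representation. *)
Lemma br_br x y z : br (br x y) z = br x (br y z) - br y (br x z).
Proof.
case: L_lie => _ _ /(_ x y z) /eqP.
by rewrite (brC z x) linearN /= (brC z) subr_eq0 => /eqP <-.
Qed.

HB.instance Definition _ x :=
  GRing.isLinear.Build k (tensor L L) (tensor L L) *:%R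
  (act br x) (@tlift_linear _ _ _ _ _).

Lemma act_tens x a b : act br x (a ⊗ b) = br x a ⊗ b + a ⊗ br x b.
Proof.
rewrite /act tlift_tens //; split=> c d y z /=.
  by rewrite br_linearr !tens_linearl scalerDr addrACA.
by rewrite br_linearr !tens_linearr scalerDr addrACA.
Qed.

Lemma act_wedge x a b :
  act br x (wedge a b) = wedge (br x a) b + wedge a (br x b).
Proof.
by rewrite /wedge linearB /= !act_tens [br x b ⊗ a + _]addrC opprD addrACA.
Qed.

Lemma act_linear_left t a x y :
  act br (a *: x + y) t = a *: act br x t + act br y t.
Proof.
apply: tlift_fun_linear => v w.
by rewrite !br_linearl tens_linearl tens_linearr scalerDr addrACA.
Qed.

(** [L ⊗ L] is a module over [L], being the tensor square of the adjoint
    representation; for [Delta_r] this is the cocycle identity. *)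
Lemma act_bracket x y t :
  act br (br x y) t = act br x (act br y t) - act br y (act br x t).
Proof.
have actE z w : act br z (act br w t) =
    tlift (fun a b => act br z (br w a ⊗ b + a ⊗ br w b)) t.
  by rewrite [act br w t]/tlift -linear_tlift.
rewrite !actE -tliftN -tliftD; apply: eq_tlift => a b.
rewrite !linearD /= !act_tens !br_br.
apply/matrixP => i j; rewrite !mxE !linearB /=; ring.
Qed.

Lemma act_tau x t : act br x (tau t) = tau (act br x t).
Proof.
rewrite [tau t]/tau linear_tlift [act br x t]/act linear_tlift.
by apply: eq_tlift => a b /=; rewrite act_tens linearD /= !tau_tens addrC.
Qed.

Lemma act_im_1_sub_tau x t :
  in_im_1_sub_tau t -> in_im_1_sub_tau (act br x t).
Proof.
by case=> t' ->; exists (act br x t'); rewrite linearB /= act_tau.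
Qed.

Section Cybe.
Context {r : tensor L L} (r_skew : skew r).

(** In [xi] of [[r13,r23]], the sum of [a' ⊗ [b,b'] ⊗ a], exchange the two
    copies of [r] and then flip the second one: the two signs, from flipping and
    from the antisymmetry of the bracket, cancel. *)
Lemma xi_r13_r23 : xi (br_r13_r23 br r) = br_r12_r23 br r.
Proof.
rewrite /br_r13_r23 /br_r12_r23 linear_tlift.
under [LHS]eq_tlift do rewrite linear_tlift /=.
rewrite tlift_exchange; apply: eq_tlift => a b.
rewrite (tlift_skew _ _ r_skew) -tliftN; apply: eq_tlift => a' b'.
by rewrite xi_tens [br b a']brC tensNl linearN.
Qed.

Lemma xi_r12_r23 : xi (br_r12_r23 br r) = br_r12_r13 br r.
Proof.
rewrite /br_r12_r23 /br_r12_r13 linear_tlift.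
under [LHS]eq_tlift do rewrite linear_tlift /=.
rewrite (tlift_skew _ _ r_skew) tlift_exchange -tliftN; apply: eq_tlift => a b.
rewrite -tliftN; apply: eq_tlift => a' b'.
by rewrite xi_tens [br a a']brC tensNl.
Qed.

Lemma xi_r12_r13 : xi (br_r12_r13 br r) = br_r13_r23 br r.
Proof.
rewrite /br_r12_r13 /br_r13_r23 linear_tlift.
under [LHS]eq_tlift do rewrite linear_tlift /=.
rewrite (tlift_skew _ _ r_skew) -tliftN; apply: eq_tlift => a b.
rewrite (tlift_skew _ _ r_skew) opprK; apply: eq_tlift => a' b'.
exact: xi_tens.
Qed.

(** [(1 ⊗ Delta_r) r] is [[r12,r23] + [r13,r23]] by definition of [Delta_r], and
    the cyclic sum of either bracket consists of all three. *)
Lemma cybe_double :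
  (br_r12_r13 br r + br_r12_r23 br r + br_r13_r23 br r) *+ 2 =
  cyc (tmap id (Delta_of br r) r).
Proof.
have -> : tmap id (Delta_of br r) r = br_r12_r23 br r + br_r13_r23 br r.
  rewrite /tmap /Delta_of /br_r12_r23 /br_r13_r23 -tliftD; apply: eq_tlift => a b.
  rewrite /act linear_tlift -tliftD; apply: eq_tlift => a' b'.
  exact: linearD.
rewrite linearD /= /cyc !(xi_r13_r23, xi_r12_r23, xi_r12_r13).
rewrite mulr2n [br_r12_r13 br r + _]addrC; congr (_ + _).
by rewrite [LHS]addrC addrA.
Qed.

End Cybe.
End Bracket.

(** * The three-dimensional case *)

(** Only the component of [D b] complementary to [a] contributes to
    [J (a ⊗ D b)], the cube being alternating. *)
Lemma cyc_tmap_id {k : fieldType} {L : vectType k}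
  (D : {linear L -> tensor L L}) (e1 e2 e3 : L) (x y a b c : k) :
  D e1 = x *: wedge e1 e2 -> D e2 = y *: wedge e1 e2 ->
  D e3 = a *: wedge e1 e2 + b *: wedge e1 e3 + c *: wedge e2 e3 ->
  [/\ cyc (tmap id D (wedge e1 e2)) = 0,
      cyc (tmap id D (wedge e1 e3)) = (c - x) *: vol e1 e2 e3
    & cyc (tmap id D (wedge e2 e3)) = (- b - y) *: vol e1 e2 e3].
Proof.
move=> D1 D2 D3; rewrite !cyc_tmap_wedge D1 D2 D3.
have cycZ d v w1 w2 : cyc (v ⊗ (d *: wedge w1 w2)) = d *: vol v w1 w2.
  by rewrite (linearZZ (tens v)) linearZZ.
have cycD v (t t' : tensor L L) :
    cyc (v ⊗ (t + t')) = cyc (v ⊗ t) + cyc (v ⊗ t').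
  by rewrite (linearD (tens v)) linearD.
rewrite !cycD !cycZ !volaab !volaba !scaler0 ?subrr ?add0r ?addr0 ?sub0r.
have -> : vol e2 e1 e3 = - vol e1 e2 e3 by rewrite volC -vol_rot.
have -> : vol e3 e1 e2 = vol e1 e2 e3 by rewrite vol_rot.
by split=> //; rewrite ?scalerN -?scaleNr -scalerDl.
Qed.

Theorem theorem2p3 (k : fieldType) (char_k : 2%N \notin [pchar k])
    (beta delta : k) (L : vectType k) (br : L -> L -> L)
    (L_lie : lie_algebra br) (e1 e2 e3 : L)
    (e_basis : basis_of {:L} [:: e1; e2; e3])
    (br12 : br e1 e2 = 0)
    (br13 : br e1 e3 = e1 + beta *: e2)
    (br23 : br e2 e3 = delta *: e2)
    (p s u : k) (r : tensor L L)
    (r_def : r = p *: (e1 ⊗ e2) - p *: (e2 ⊗ e1)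
               + s *: (e1 ⊗ e3) - s *: (e3 ⊗ e1)
               + u *: (e2 ⊗ e3) - u *: (e3 ⊗ e2)) :
  let coboundary := coboundary_lie_bialgebra br (Delta_of br r) r in
  let triangular := triangular_lie_bialgebra br (Delta_of br r) r in
  [/\ coboundary <->
        (delta + 1) * ((delta - 1) * u + beta * s) * s = 0,
      beta = 0 ->
        (triangular <-> (1 - delta) * u * s = 0)
    & beta <> 0 -> delta = 1 ->
        (triangular <-> s = 0) /\ (s = 0 <-> coboundary)].
Proof.
move=> coboundary triangular.
have rE : r = p *: wedge e1 e2 + s *: wedge e1 e3 + u *: wedge e2 e3.
  by rewrite r_def /wedge !scalerBr !addrA.
have r_skew : skew r by move=> i j; rewrite r_def !mxE; ring.
have r_im : in_im_1_sub_tau r.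
  exists (p *: (e1 ⊗ e2) + s *: (e1 ⊗ e3) + u *: (e2 ⊗ e3)).
  rewrite !linearD !linearZ /= !tau_tens r_def.
  by apply/matrixP => i j; rewrite !mxE; ring.
pose D : {linear L -> tensor L L} :=
  HB.pack (Delta_of br r) (GRing.isLinear.Build k L _ *:%R (Delta_of br r)
    (act_linear_left L_lie r)).
have br21 : br e2 e1 = 0 by rewrite (brC L_lie) br12 oppr0.
have br31 : br e3 e1 = - (e1 + beta *: e2) by rewrite (brC L_lie) br13.
have br32 : br e3 e2 = - (delta *: e2) by rewrite (brC L_lie) br23.
have brE := (brxx L_lie, br12, br13, br23, br21, br31, br32).
have DE x : D x = p *: act br x (wedge e1 e2) + s *: act br x (wedge e1 e3)
     + u *: act br x (wedge e2 e3).
  by rewrite /D /= /Delta_of rE !linearD !linearZ.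
(* Reading off matrix entries turns the identity into one in the field. *)
have D1 : D e1 = (beta * s - u) *: wedge e1 e2.
  rewrite DE !(act_wedge L_lie) !brE; apply/matrixP=> i j.
  rewrite !mxE ?(linear0, linearD, linearZ) /=; ring.
have D2 : D e2 = (delta * s) *: wedge e1 e2.
  rewrite DE !(act_wedge L_lie) !brE; apply/matrixP=> i j.
  rewrite !mxE ?(linear0, linearD, linearZ) /=; ring.
have D3 : D e3 = - (p * (1 + delta)) *: wedge e1 e2 + - s *: wedge e1 e3
              + - (beta * s + delta * u) *: wedge e2 e3.
  rewrite DE !(act_wedge L_lie) !brE; apply/matrixP=> i j.
  rewrite !mxE ?(linear0, linearN, linearD, linearZ) /=; ring.
have [K12 K13 K23] := cyc_tmap_id D _ _ _ _ _ _ _ _ D1 D2 D3.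
set c := (delta - 1) * u + beta * s.
have vol0 := vol_neq0 _ _ _ e_basis.
have KD t t' : cyc (tmap id D (t + t')) = cyc (tmap id D t) + cyc (tmap id D t').
  by rewrite [tmap id D _]linearD linearD.
have KZ d t : cyc (tmap id D (d *: t)) = d *: cyc (tmap id D t).
  by rewrite (linearZZ (tmap id D)) linearZZ.
(* Co-Jacobi is linear in x, so the basis vectors suffice. *)
have K1 : cyc (tmap id D (D e1)) = 0.
  by rewrite D1 KZ K12 scaler0.
have K2 : cyc (tmap id D (D e2)) = 0.
  by rewrite D2 KZ K12 scaler0.
have K3 : cyc (tmap id D (D e3)) = ((delta + 1) * c * s) *: vol e1 e2 e3.
  rewrite D3 !KD !KZ K12 K13 K23 scaler0 add0r !scalerA -scalerDl.
  by congr (_ *: _); rewrite /c; ring.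
have Kr : cyc (tmap id D r) = - (c * s *+ 2) *: vol e1 e2 e3.
  rewrite rE !KD !KZ K12 K13 K23 scaler0 add0r !scalerA -scalerDl.
  by congr (_ *: _); rewrite /c; ring.
have nz2 : 2%:R != 0 :> k by apply: contra char_k => ?; rewrite inE.
have cybeE : cybe br r <-> c * s = 0.
  have C2 := cybe_double L_lie r_skew.
  rewrite -[Delta_of br r]/(D : L -> _) Kr in C2; rewrite /cybe; split=> [C0|cs0].
    move/esym/eqP: C2; rewrite C0 mul0rn scaler_eq0 (negPf vol0) orbF oppr_eq0.
    by rewrite -mulr_natl mulf_eq0 (negPf nz2) => /eqP.
  move/eqP: C2; rewrite cs0 mul0rn oppr0 scale0r -scaler_nat scaler_eq0.
  by rewrite (negPf nz2) => /eqP.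
have cobE : coboundary <-> (delta + 1) * c * s = 0.
  split=> [[[_ [_ _ /(_ e3) coJ] _] _ _]|c0].
    move/eqP: (coJ : cyc (tmap id D (D e3)) = 0).
    by rewrite K3 scaler_eq0 (negPf vol0) orbF => /eqP.
  split=> //; split=> //; last by move=> x y; exact: act_bracket.
  split=> [|x|x]; [exact: act_linear_left|exact: act_im_1_sub_tau|].
  suff: cyc (tmap id D (D x)) = 0 by [].
  have /coord_span -> : x \in <<[tuple e1; e2; e3]>>%VS.
    by rewrite (span_basis e_basis) memvf.
  rewrite !big_ord_recl big_ord0 addr0 !(linearD D) !(linearZZ D) /= !KD !KZ.
  by rewrite K1 K2 K3 c0 scale0r !scaler0 !addr0.
have triE : triangular <-> c * s = 0.
  split=> [[_ /cybeE]//|cs0]; split; last exact/cybeE.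
  by apply/cobE; rewrite -mulrA cs0 mulr0.
split=> [//|b0|/eqP b0 d1].
  rewrite triE /c b0 mul0r addr0 -(opprB delta 1) !mulNr.
  by split=> [->|/eqP]; rewrite ?oppr0 // oppr_eq0 => /eqP.
have c1 : c = beta * s by rewrite /c d1 subrr mul0r add0r.
have s0E : c * s = 0 <-> s = 0.
  rewrite c1; split=> [/eqP|->]; last by rewrite mulr0.
  by rewrite !mulf_eq0 (negPf b0) orbb => /eqP.
split; first by rewrite triE.
rewrite cobE d1 -s0E -mulrA; split=> [->|/eqP]; first by rewrite mulr0.
by rewrite mulf_eq0 (negPf nz2) => /eqP.
Qed.
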